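(* Let $n\ge 2$ and let $G\subset\overline{\mathbb{R}^n}$ be a domain (open connected set) with $\operatorname{card}\partial G\ge 2$. Then: (i) For all $x,y\in G$, $$\delta_G(x,y)\le \rho_G(x,y)\le \frac{\operatorname{arch} 3}{\log 3}\,\delta_G(x,y).$$ Assume additionally that $G\subset\mathbb{R}^n$. Then: (ii) For all $x,y\in G$, $$j_G(x,y)\le \rho_G(x,y)\le \frac{\operatorname{arch} 3}{\log 2}\,j_G(x,y).$$ Moreover, both inequalities in (i) and the first inequality in (ii) are sharp. Here an inequality $d_1\le c\,d_2$ between metrics is called sharp if the constant $c$ cannot be improved, i.e. there exist a domain $G$ satisfying the respective hypotheses and points $x_i,y_i\in G$, $x_i\ne y_i$, $i=1,2,\dots$, such that $\lim_{i\to\infty} d_1(x_i,y_i)/d_2(x_i,y_i)=c$.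
   Context: $\overline{\mathbb{R}^n}=\mathbb{R}^n\cup\{\infty\}$ is the one-point compactification of $\mathbb{R}^n$, equipped with the spherical (chordal) metric $$q(x,y)=\frac{|x-y|}{\sqrt{1+|x|^2}\sqrt{1+|y|^2}}\quad (x,y\in\mathbb{R}^n),\qquad q(x,\infty)=\frac{1}{\sqrt{1+|x|^2}}\quad (x\in\mathbb{R}^n),\qquad q(\infty,\infty)=0.$$ All topological operations, in particular the boundary $\partial G$, are taken in $\overline{\mathbb{R}^n}$ (so $\infty\in\partial G$ for an unbounded $G\subset\mathbb{R}^n$). The cross-ratio of $a,b,c,d\in\overline{\mathbb{R}^n}$ with $a\ne b$, $c\ne d$ is $$|a,b,c,d|=\frac{q(a,c)\,q(b,d)}{q(a,b)\,q(c,d)},$$ which for $a,b,c,d\in\mathbb{R}^n$ equals $\dfrac{|a-c||b-d|}{|a-b||c-d|}$. $\operatorname{arch}(t)=\log(t+\sqrt{t^2-1})$ for $t\ge 1$ is the inverse hyperbolic cosine. For a domain $G\subset\overline{\mathbb{R}^n}$ with at least two boundary points and $x,y\in G$: - generalized hyperbolic metric: $\rho_G(x,y)=\sup_{a,b\in\partial G}\operatorname{arch}\bigl(1+|a,x,b,y|\,|a,y,b,x|/2\bigr)$; - Seittenranta's metric: $\delta_G(x,y)=\sup_{a,b\in\partial G}\log\bigl(1+|a,x,b,y|\bigr)$; - if $G\subset\mathbb{R}^n$: $j_G(x,y)=\log\left(1+\dfrac{|x-y|}{\min\{d(x),d(y)\}}\right)$, where $d(x)$ is the Euclidean distance from $x$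 to $\partial G\setminus\{\infty\}$. *)

(* Defs.v *)
From HB Require Import structures.
From mathcomp Require Import all_boot all_order all_algebra.
From mathcomp Require Import all_classical all_reals all_analysis.
Set Implicit Arguments.
Unset Strict Implicit.
Unset Printing Implicit Defensive.
Import Order.TTheory GRing.Theory Num.Theory.
Import numFieldNormedType.Exports.
Local Open Scope classical_set_scope.
Local Open Scope ring_scope.

(* [Some u] is the point u of R^n and [None] is the point at infinity. The
   library topology of 'rV[R]_n is the one of the sup norm, i.e. the usual one;
   the topology that q induces on the compactification is the library's. *)
Definition mobius_space (R : realType) (n : nat) :=
  one_point_compactification 'rV[R]_n.

Section MobiusMetrics.
Context {R : realType} {n : nat}.
Implicit Types (G : set (mobius_space R n)) (u v : 'rV[R]_n).
Implicit Types (a b c d x y : mobius_space R n).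

(* The library norm `|u| of a row vector is the sup norm. *)
Definition eucl_norm u : R := Num.sqrt (\sum_(i < n) u 0 i ^+ 2).

Definition eucl_dist u v : R := eucl_norm (u - v).

Definition q x y : R :=
  match x, y with
  | Some u, Some v =>
      eucl_dist u v /
      (Num.sqrt (1 + eucl_norm u ^+ 2) * Num.sqrt (1 + eucl_norm v ^+ 2))
  | Some u, None | None, Some u => 1 / Num.sqrt (1 + eucl_norm u ^+ 2)
  | None, None => 0
  end.

Definition cross_ratio a b c d : R := (q a c * q b d) / (q a b * q c d).

Definition arch (t : R) : R := ln (t + Num.sqrt (t ^+ 2 - 1)).

Definition boundary G : set (mobius_space R n) := closure G `\` interior G.

(* The condition card (boundary G) >= 2 is part of the definition. *)
Definition admissible_domain G : Prop :=
  [/\ open G, connected G & (`I_2 #<= boundary G)%card].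

Definition finite_domain G : Prop := G `<=` range (@Some 'rV[R]_n).

(* For x, y in an open G, the two sets below are nonempty as soon as the
   boundary is, and bounded above, since q a x and q a y are bounded away from
   0 for a in the boundary; so the real-valued sup is the actual supremum. *)
Definition rho G x y : R :=
  sup [set arch (1 + cross_ratio a x b y * cross_ratio a y b x / 2)
      | a in boundary G & b in boundary G].

Definition delta G x y : R :=
  sup [set ln (1 + cross_ratio a x b y) | a in boundary G & b in boundary G].

Definition bdist G u : R :=
  inf [set eucl_dist u v | v in [set v | boundary G (Some v)]].

(* Only meaningful for G in R^n; the value 0 at infinity is a dummy. *)
Definition jmetric G x y : R :=
  match x, y with
  | Some u, Some v =>
      ln (1 + eucl_dist u v / Num.min (bdist G u) (bdist G v))
  | _, _ => 0
  end.

(* Sharpness of d1 <= k * d2 over the domains satisfying H. *)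
Definition sharp (H : set (mobius_space R n) -> Prop)
    (d1 d2 : set (mobius_space R n) -> mobius_space R n -> mobius_space R n -> R)
    (k : R) : Prop :=
  exists G, H G /\
  exists x y : nat -> mobius_space R n,
    (forall i, [/\ G (x i), G (y i) & x i <> y i]) /\
    (d1 G (x i) (y i) / d2 G (x i) (y i)) @[i --> \oo] --> k.

End MobiusMetrics.

(* Main.v *)
Require Import Defs.
From HB Require Import structures.
From mathcomp Require Import all_boot all_order all_algebra.
From mathcomp Require Import all_classical all_reals all_analysis.
From mathcomp Require Import ring lra.
Set Implicit Arguments.
Unset Strict Implicit.
Import Order.TTheory GRing.Theory Num.Theory.
Import numFieldNormedType.Exports.
Local Open Scope classical_set_scope.
Local Open Scope ring_scope.

(* For boundary points a, b put s = |a,x,b,y| and t = |a,y,b,x|. Ptolemy's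
   inequality for the chordal metric gives s <= t (1 + s), t <= s (1 + t) and
   s t <= s + t. The first says 1 + st/2 >= cosh (log (1 + s)), hence
   delta <= rho. The last gives st <= s^2 / (s - 1) for the larger s >= 2, and
   st <= s^2 for s <= 2; both bounds are worst at s = t = 2, where
   arch (1 + st/2) / log (1 + s) = arch 3 / log 3.
   For (ii), the ray from y pointing away from a boundary point a leaves G
   through a boundary point b (possibly oo) which is closer to y than to a, so
   that s >= |x - y| / |x - a|. Conversely, with d the smaller distance to the
   boundary and u = |x - y| / d, one has st <= 4 u^2, and
   st <= 4 u^4 / (2 u^2 - 1) for u >= 1.
   Sharpness is attained in the punctured space: all three metrics agree at e
   and 2 e, while rho = arch 3 and delta = log 3 at e and - e. *)

(** * The inverse hyperbolic cosine and its value at 3 *)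

Section Arch.
Variable R : realType.
Implicit Types s t x y z p u c : R.

Lemma ler_ln_pos x y : 0 < x -> x <= y -> ln x <= ln y :> R.
Proof. by move=> x0 xy; rewrite ler_ln// posrE// (lt_le_trans x0). Qed.

Lemma lnX (n : nat) x : 0 < x -> ln (x ^+ n) = n%:R * ln x.
Proof. by move=> x0; rewrite lnXn// mulr_natl. Qed.

(** The parametrization t = cosh (ln p) has p = t + sqrt (t^2 - 1), whose inverse is the conjugate t
    - sqrt (t^2 - 1). It turns comparisons of [arch] with [ln] into comparisons of p + 1/p. *)
Lemma archP t : 1 <= t -> exists p,
  [/\ 1 <= p, t = (p + p^-1) / 2 & arch t = ln p].
Proof.
move=> t1; exists (t + Num.sqrt (t ^+ 2 - 1)).
set s := Num.sqrt _.
have s0 : 0 <= s by exact: sqrtr_ge0.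
have ss : s ^+ 2 = t ^+ 2 - 1 by rewrite sqr_sqrtr//; nra.
have p1 : 1 <= t + s by lra.
split => //.
have -> : (t + s)^-1 = t - s.
  apply: (mulfI (_ : t + s != 0)); first by rewrite gt_eqF//; lra.
  by rewrite divff ?gt_eqF//; [move: ss; rewrite !expr2; lra|lra].
by field.
Qed.

Lemma leD_inv x y : 1 <= x -> 1 <= y -> (x + x^-1 <= y + y^-1) = (x <= y).
Proof.
move=> x1 y1.
have -> : (x + x^-1 <= y + y^-1) = (0 <= (y - x) * ((x * y - 1) / (x * y))).
  rewrite -subr_ge0; congr (0 <= _); field.
  by apply/andP; split; rewrite gt_eqF//; lra.
have xy0 : 0 < x * y by nra.
have [->|xy] := eqVneq x y; first by rewrite subrr mul0r !lexx.
rewrite pmulr_lge0 ?subr_ge0// divr_gt0// subr_gt0.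
by case: (ltgtP x y) xy => // ? _; nra.
Qed.

Lemma ln_le_arch t z : 1 <= z -> (z + z^-1) / 2 <= t -> ln z <= arch t.
Proof.
move=> z1 zt; have z2 : 2 <= z + z^-1.
  have : 1 + 1^-1 <= z + z^-1 by rewrite leD_inv.
  by rewrite invr1; lra.
have [|p [p1 tp ->]] := @archP t; first lra.
by apply: ler_ln_pos; [lra|rewrite -leD_inv//; lra].
Qed.

Lemma arch_le_ln t z : 1 <= t -> 1 <= z -> t <= (z + z^-1) / 2 -> arch t <= ln z.
Proof.
move=> t1 z1 tz; have [//|p [p1 tp ->]] := @archP t.
by apply: ler_ln_pos; [lra|rewrite -leD_inv//; lra].
Qed.

Lemma arch_cosh z : 1 <= z -> arch ((z + z^-1) / 2) = ln z.
Proof.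
move=> z1; apply/eqP; rewrite eq_le ln_le_arch// arch_le_ln//.
have : 1 + 1^-1 <= z + z^-1 by rewrite leD_inv.
by rewrite invr1; lra.
Qed.

Lemma arch_mono t t' : 1 <= t -> t <= t' -> arch t <= arch t'.
Proof.
by move=> t1 tt'; have [//|p [p1 tp ->]] := @archP t; apply: ln_le_arch; lra.
Qed.

Local Notation r2 := (@Num.sqrt R 2).

Lemma sqrt2_bounds : [/\ 0 < r2, r2 * r2 = 2, 7 / 5 <= r2 & r2 <= 10 / 7].
Proof.
have r20 : 0 < r2 by rewrite sqrtr_gt0.
have r22 : r2 * r2 = 2 by rewrite -expr2 sqr_sqrtr.
by split => //; nra.
Qed.

Lemma inv_3D2sqrt2 : (3 + 2 * r2)^-1 = 3 - 2 * r2.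
Proof.
case: sqrt2_bounds => r20 r22 _ _; apply: (mulfI (_ : 3 + 2 * r2 != 0)).
  by rewrite gt_eqF//; lra.
by rewrite divff ?gt_eqF//; lra.
Qed.

Lemma arch3E : arch 3 = ln (3 + 2 * r2).
Proof.
case: sqrt2_bounds => r20 r22 _ _.
rewrite -arch_cosh; last lra.
by rewrite inv_3D2sqrt2; congr arch; field.
Qed.

Lemma ln2_gt0 : 0 < ln 2 :> R. Proof. by rewrite ln_gt0//; lra. Qed.
Lemma ln3_gt0 : 0 < ln 3 :> R. Proof. by rewrite ln_gt0//; lra. Qed.

(** Places the constant arch 3 / ln 3 between 1 and 2; the upper bound amounts to 3 + 2 sqrt 2 <=
    9. *)
Lemma arch3_ln3 : ln (3 : R) <= arch (3 : R) <= 2 * ln 3.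
Proof.
case: sqrt2_bounds => r20 r22 rl ru; rewrite arch3E; apply/andP; split.
  by apply: ler_ln_pos; lra.
by rewrite (mulr_natl (ln 3)) -lnXn; [apply: ler_ln_pos; rewrite ?expr2; lra|lra].
Qed.

(** Places arch 3 / ln 2 between 5/2 and 8/3, by comparing (3 + 2 sqrt 2)^2 with 2^5 and (3 + 2 sqrt
    2)^3 with 2^8. *)
Lemma arch3_ln2 : 5 / 2 * ln (2 : R) <= arch (3 : R) <= 8 / 3 * ln 2.
Proof.
case: sqrt2_bounds => r20 r22 rl ru; rewrite arch3E; apply/andP; split.
  suff : ln (2 ^+ 5) <= ln ((3 + 2 * r2) ^+ 2).
    by rewrite (lnX 5) ?(lnX 2); lra.
  by apply: ler_ln_pos; rewrite ?exprn_gt0//; rewrite !exprS expr0; lra.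
suff : ln ((3 + 2 * r2) ^+ 3) <= ln (2 ^+ 8).
  by rewrite (lnX 8) ?(lnX 3); lra.
apply: ler_ln_pos; first by rewrite exprn_gt0//; lra.
rewrite !exprS expr0.
have -> : (3 + 2 * r2) * ((3 + 2 * r2) * ((3 + 2 * r2) * 1)) =
  27 + 54 * r2 + 36 * (r2 * r2) + 8 * (r2 * r2) * r2 by ring.
by rewrite r22; lra.
Qed.

End Arch.

(** * Comparison of [arch] with the logarithms of 1 + s and 1 + u *)

Section ArchBounds.
Variable R : realType.
Implicit Types s t x y z p u c : R.

Local Notation r2 := (@Num.sqrt R 2).

(* The derivative of c ln (1 + l (p - 1/p)) - 2 ln p changes sign at most once
   on [1, P], from + to -, so its minimum is attained at an end point. *)
Lemma ln_chord (l c P p : R) : 0 < l -> 0 <= c -> l * (c - 2) * P <= 1 ->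
  c * ln (1 + l * (P - P^-1)) = 2 * ln P -> 1 <= p <= P ->
  2 * ln p <= c * ln (1 + l * (p - p^-1)).
Proof.
move=> l0 c0 lcP hP /andP[p1 pP].
pose h x := x + l * (x * x - 1).
pose f x := c * ln (h x) - (c + 2) * ln x.
(* [N] is the derivative of [f] times the positive factor x h(x), hence has its sign. *)
pose N x := l * (c - 2) * (x * x) - 2 * x + l * (c + 2).
pose df x := c * ((h x)^-1 * (1 + l * (x + x))) - (c + 2) * x^-1.
have h_gt0 x : 1 <= x -> 0 < h x.
  move=> x1; rewrite /h.
  have : 0 <= l * (x * x - 1) by apply: mulr_ge0; nra.
  by lra.
have fE x : 1 <= x -> f x = c * ln (1 + l * (x - x^-1)) - 2 * ln x.
  move=> x1; rewrite /f.
  have x0 : 0 < x by lra.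
  have -> : h x = x * (1 + l * (x - x^-1)).
    rewrite mulrDr mulr1 mulrCA mulrBr divff ?gt_eqF//.
  have i1 : x^-1 <= 1 by rewrite invf_le1.
  have : 0 <= l * (x - x^-1) by apply: mulr_ge0; lra.
  move=> ?; rewrite lnM ?posrE//; last by lra.
  by lra.
have fdf x : 1 <= x -> is_derive x 1 f (df x).
  move=> x1; have x0 : 0 < x by lra.
  have H1 : is_derive x 1 h (1 + l * (x + x)).
    have -> : h = id + (l \*: (id * id - cst 1)) by apply/funext => y.
    by apply: is_derive_eq; rewrite /GRing.scale/= !mulr1 subr0.
  have H2 := is_derive1_ln (h_gt0 _ x1).
  have H3 : is_derive x 1 (@ln R \o h) ((h x)^-1 * (1 + l * (x + x))).
    exact: is_derive1_comp.
  have H4 := is_derive1_ln x0.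
  have -> : f = (c \*: (@ln R \o h) - (c + 2) \*: (@ln R)) by apply/funext => y.
  exact: is_deriveB.
have dfN x : 1 <= x -> df x * (x * h x) = N x.
  move=> x1; have x0' : x != 0 by rewrite gt_eqF//; lra.
  have hx0 : h x != 0 by rewrite gt_eqF// h_gt0.
  have -> : df x * (x * h x) =
     c * (1 + l * (x + x)) * x * ((h x)^-1 * h x) - (c + 2) * (x^-1 * x) * h x.
    by rewrite /df; ring.
  by rewrite !mulVf// /h /N; ring.
have cf (a b : R) : 1 <= a -> {within `[a, b], continuous f}.
  move=> a1; apply: derivable_within_continuous => x.
  rewrite in_itv/= => /andP[ax _].
  by have [] := fdf x (le_trans a1 ax).
have f1 : f 1 = 0 by rewrite fE// invr1 subrr mulr0 addr0 ln1 !mulr0 subrr.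
have fP : f P = 0 by rewrite fE ?hP ?subrr//; lra.
(* [N] is nonincreasing on [1, P]: when c > 2, the sum x + y is at most 2 P, and l (c - 2) P <= 1 by
   hypothesis. *)
have N_le (x y : R) : x <= y <= P -> 1 <= x -> N y <= N x.
  move=> /andP[xy yP] x1; rewrite -subr_ge0.
  have -> : N x - N y = (y - x) * (2 - l * (c - 2) * (x + y)) by rewrite /N; ring.
  have [c2|c2] := leP c 2; apply: mulr_ge0; rewrite ?subr_ge0//.
    have lc : l * (c - 2) <= 0 by rewrite pmulr_rle0// subr_le0.
    have : l * (c - 2) * (x + y) <= 0 by rewrite mulr_le0_ge0//; lra.
    by lra.
  have lc : 0 <= l * (c - 2) by rewrite mulr_ge0; lra.
  have : l * (c - 2) * (x + y) <= l * (c - 2) * (P + P) by apply: ler_wpM2l; lra.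
  by lra.
rewrite -subr_ge0 -fE//.
(* If N p >= 0, then [f] is nondecreasing on [1, p], starting from f 1 = 0; otherwise it decreases
   on [p, P] down to f P = 0. *)
have [Np|Np] := leP 0 (N p).
  have [//|x xi||x] := @MVT_segment R f df 1 p; rewrite ?f1 ?subr0.
  - by apply: fdf; move: xi; rewrite in_itv/= => /andP[/ltW].
  - exact: cf.
  rewrite in_itv/= => /andP[x1 xp] ->.
  apply: mulr_ge0; last by rewrite subr_ge0.
  have D0 : 0 < x * h x by rewrite mulr_gt0 ?h_gt0//; lra.
  by rewrite -(pmulr_lge0 _ D0) dfN// (le_trans Np)// N_le// xp.
have [//|x xi||x] := @MVT_segment R f df p P.
- by apply: fdf; move: xi; rewrite in_itv/= => /andP[/ltW/(le_trans p1)].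
- exact: cf.
rewrite in_itv/= fP sub0r => /andP[px xP] /eqP; rewrite eqr_oppLR => /eqP ->.
have x1 := le_trans p1 px.
rewrite -mulNr; apply: mulr_ge0; last by rewrite subr_ge0.
rewrite oppr_ge0.
have D0 : 0 < x * h x by rewrite mulr_gt0 ?h_gt0//; lra.
by rewrite -(pmulr_lle0 _ D0) dfN// (le_trans _ (ltW Np))// N_le// px.
Qed.

(** Here p = e^theta with v = 2 sinh theta; in the proof [w] is cosh theta. *)
Lemma subr_invP v : 0 <= v -> exists2 p : R, 1 <= p & v = p - p^-1.
Proof.
move=> v0; set w := Num.sqrt ((v / 2) ^+ 2 + 1).
have w0 : 0 <= w by exact: sqrtr_ge0.
have ww : w ^+ 2 = (v / 2) ^+ 2 + 1 by rewrite sqr_sqrtr//; nra.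
have w1 : 1 <= w.
  by rewrite -(@ler_pXn2r _ 2) ?nnegrE// expr1n ww lerDr sqr_ge0.
exists (v / 2 + w); first lra.
have -> : (v / 2 + w)^-1 = w - v / 2.
  apply: (mulfI (_ : v / 2 + w != 0)); first by rewrite gt_eqF//; lra.
  rewrite divff ?gt_eqF//; last lra.
  by move: ww; rewrite !expr2; lra.
by field.
Qed.

Lemma ler_subr_inv p p' : 1 <= p -> 1 <= p' ->
  p - p^-1 <= p' - p'^-1 -> p <= p'.
Proof.
move=> p1 p'1 h; rewrite leNgt; apply/negP => p'p.
have : p^-1 < p'^-1 by rewrite ltf_pV2// posrE; lra.
lra.
Qed.

(** The double angle formula cosh (2 theta) = 1 + 2 (sinh theta)^2 at theta = ln p. *)
Lemma arch_subr_inv p : 1 <= p -> arch (1 + (p - p^-1) ^+ 2 / 2) = 2 * ln p.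
Proof.
move=> p1; have p0 : 0 < p by lra.
rewrite -(lnX 2)// -(@arch_cosh _ (p ^+ 2)); last by rewrite exprn_ege1.
congr arch; rewrite sqrrB exprVn divff ?gt_eqF// mulr2n.
by move: (p ^- 2) => b; field.
Qed.

(** P is 1 + sqrt 2, the value of p at which v = p - 1/p is 2 and arch (1 + v^2 / 2) is arch 3. It
    is the right end point in both applications of [ln_chord]. *)
Lemma silver_ratio : exists P : R,
  [/\ 1 <= P <= 5 / 2, P - P^-1 = 2 & arch 3 = 2 * ln P].
Proof.
have [//|P P1 PP] := @subr_invP 2.
exists P; split => //.
  rewrite P1 leNgt; apply/negP => P5.
  have : P^-1 < (5 / 2)^-1 by rewrite ltf_pV2// posrE; lra.
  by rewrite invf_div; lra.
by rewrite -arch_subr_inv// -PP; congr arch; field.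
Qed.

Lemma ln_le_arch_prod s t : 0 <= s -> s <= t * (1 + s) ->
  ln (1 + s) <= arch (1 + s * t / 2).
Proof.
move=> s0 st; apply: ln_le_arch; first lra.
rewrite -subr_ge0.
have -> : 1 + s * t / 2 - (1 + s + (1 + s)^-1) / 2 =
    s * (t * (1 + s) - s) / (2 * (1 + s)).
  by field; rewrite gt_eqF//; lra.
by rewrite divr_ge0 ?mulr_ge0 ?subr_ge0//; lra.
Qed.

Let ln2_gt0 := ln2_gt0 R.
Let ln3_gt0 := ln3_gt0 R.

Lemma arch_prod_le s t : 0 <= t -> t <= s -> s * t <= s + t ->
  arch (1 + s * t / 2) <= arch 3 / ln 3 * ln (1 + s).
Proof.
move=> t0 ts st.
have /andP[c1 c2] := arch3_ln3 R.
set c := arch 3 / ln 3.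
have cE : c * ln 3 = arch 3 by rewrite /c divfK// gt_eqF.
have c1' : 1 <= c by rewrite /c ler_pdivlMr// mul1r.
have c2' : c <= 2 by rewrite /c ler_pdivrMr.
(* For s <= 2, use s t <= s^2 and s = p - 1/p; then [ln_chord] with l = 1 compares 2 ln p with c ln
   (1 + s), the two being equal at s = 2. *)
have [s2|s2] := leP s 2.
  have [|p p1 sp] := @subr_invP s; first lra.
  have [P [/andP[P1 P5] PP archP]] := silver_ratio.
  apply: (@le_trans _ _ (arch (1 + s ^+ 2 / 2))).
    by apply: arch_mono; rewrite ?expr2; nra.
  rewrite sp arch_subr_inv// -[p - _]mul1r; apply: (@ln_chord _ _ P) => //.
  - lra.
  - have : (c - 2) * P <= 0 by rewrite mulr_le0_ge0//; lra.
    by lra.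
  - by rewrite PP mul1r -archP -cE; congr (_ * ln _); lra.
  - by rewrite p1/=; apply: ler_subr_inv; lra.
have [r20 r22 rl ru] := sqrt2_bounds R.
have L3 : ln 3 <= ln (1 + s) by apply: ler_ln_pos; lra.
(* As c >= 1 and s > 2, c ln (1 + s) >= arch 3 + ln ((1 + s) / 3). *)
apply: (@le_trans _ _ (ln ((3 + 2 * r2) * ((1 + s) / 3)))); last first.
  rewrite lnM ?posrE; [|lra|lra].
  rewrite ln_div ?posrE; [|lra|lra].
  by rewrite -arch3E -cE; nra.
apply: arch_le_ln.
- by nra.
- by nra.
rewrite invfM inv_3D2sqrt2 invf_div -subr_ge0.
have tle : s * t <= s + 1 + (s - 1)^-1.
  have -> : s + 1 + (s - 1)^-1 = s * (s / (s - 1)) by field; rewrite gt_eqF//; lra.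
  by rewrite ler_wpM2l ?ler_pdivlMr//; lra.
(* The difference with s t replaced by its bound s^2 / (s - 1), in factored form; it vanishes at s =
   2. *)
apply: (@le_trans _ _ ((s - 2) * (2 * r2 * (s - 1) * (s + 4) - 6 * (s - 2)) /
   (6 * (s - 1) * (s + 1)))).
  apply: divr_ge0; last by apply: mulr_ge0; lra.
  apply: mulr_ge0; first lra.
  have h1 : 1 * (s - 1) * (s + 4) <= r2 * (s - 1) * (s + 4).
    by rewrite ler_wpM2r ?ler_wpM2r//; lra.
  by nra.
have -> : (s - 2) * (2 * r2 * (s - 1) * (s + 4) - 6 * (s - 2)) /
   (6 * (s - 1) * (s + 1)) = ((3 + 2 * r2) * ((1 + s) / 3) +
   (3 - 2 * r2) * (3 / (1 + s))) / 2 - (1 + (s + 1 + (s - 1)^-1) / 2).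
  by field; apply/andP; split; rewrite gt_eqF//; lra.
by lra.
Qed.

(** Applied with u = |x - y| / d and Y = s t. Both bounds on Y equal 4 at u = 1, where the two sides
    become arch 3. The ranges 1 < u <= 3 and u > 3 use different lower bounds for the right-hand
    side. *)
Lemma arch_le_jbound u Y : 0 <= u -> 0 <= Y -> Y <= 4 * u ^+ 2 ->
  (1 <= u -> Y * (2 * u ^+ 2 - 1) <= 4 * u ^+ 4) ->
  arch (1 + Y / 2) <= arch 3 / ln 2 * ln (1 + u).
Proof.
move=> u0 Y0 Yu YU.
have /andP[c1 c2] := arch3_ln2 R.
set c := arch 3 / ln 2.
have cE : c * ln 2 = arch 3 by rewrite /c divfK// gt_eqF.
have c1' : 5 / 2 <= c by rewrite /c ler_pdivlMr.
have c2' : c <= 8 / 3 by rewrite /c ler_pdivrMr.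
(* For u <= 1, [ln_chord] applies with l = 1/2 and 2 u = p - 1/p; its condition l (c - 2) P <= 1
   follows from c <= 8/3 and P <= 5/2. *)
have [u1|u1] := leP u 1.
  have [|p p1 up] := @subr_invP (2 * u); first lra.
  have [P [/andP[P1 P5] PP archP]] := silver_ratio.
  apply: (@le_trans _ _ (arch (1 + (2 * u) ^+ 2 / 2))).
    by apply: arch_mono; rewrite ?exprMn; lra.
  have -> : 1 + u = 1 + 1 / 2 * (p - p^-1) by rewrite -up; lra.
  rewrite up arch_subr_inv//; apply: (@ln_chord _ _ P) => //.
  - lra.
  - have : (c - 2) * P <= (8 / 3 - 2) * (5 / 2) by apply: ler_pM; lra.
    by lra.
  - by rewrite PP -archP -cE; congr (_ * ln _); lra.
  - by rewrite p1/=; apply: ler_subr_inv; lra.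
have uu : 1 <= u * u by nra.
have {YU} Yle : Y <= 2 * (u * u) + 1 + (2 * (u * u) - 1)^-1.
  have -> : 2 * (u * u) + 1 + (2 * (u * u) - 1)^-1 = 4 * u ^+ 4 / (2 * u ^+ 2 - 1).
    by field; rewrite gt_eqF//; lra.
  by rewrite ler_pdivlMr ?YU//; [exact: ltW|rewrite expr2; lra].
have [r20 r22 rl ru] := sqrt2_bounds R.
have [u3|u3] := leP u 3.
  have L2 : ln 2 <= ln (1 + u) by apply: ler_ln_pos; lra.
  have z1 : 1 <= ((1 + u) / 2) ^+ 2 by rewrite exprn_ege1//; lra.
  have z0 : 0 < ((1 + u) / 2) ^+ 2 by lra.
  (* As c >= 2, c ln (1 + u) >= arch 3 + 2 ln ((1 + u) / 2). *)
  apply: (@le_trans _ _ (ln ((3 + 2 * r2) * ((1 + u) / 2) ^+ 2))); last first.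
    have e0 : 0 < 3 + 2 * r2 by lra.
    rewrite lnM ?posrE//.
    rewrite (lnX 2); last lra.
    rewrite ln_div ?posrE; [|lra|lra].
    by rewrite -arch3E -cE; nra.
  apply: arch_le_ln.
  - by nra.
  - by nra.
  rewrite invfM inv_3D2sqrt2 -subr_ge0.
  set k := ((1 + u) / 2) ^+ 2 in z0 z1 *; set k' := k^-1.
  have k'1 : k' <= 1 by rewrite invf_le1.
  (* Replacing sqrt 2 by 7/5 in 3 + 2 sqrt 2 and 3 - 2 sqrt 2 gives the coefficients 29/5 and 1/5;
     this lowers the sum because k >= 1 >= 1/k. *)
  suff : 2 * (u * u) + 3 + (2 * (u * u) - 1)^-1 <= 29 / 5 * k + 1 / 5 * k'.
    have : 7 / 5 * (k - k') <= r2 * (k - k') by rewrite ler_wpM2r// subr_ge0; lra.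
    by lra.
  rewrite -subr_ge0 /k' /k.
  set m := 2 * (u * u) - 1.
  have m0 : 0 < m by rewrite /m; lra.
  have W0 : 0 < k * m by apply: mulr_gt0.
  rewrite -(pmulr_lge0 _ W0).
  have -> : (29 / 5 * k + 1 / 5 * k^-1 - (2 * (u * u) + 3 + m^-1)) * (k * m) =
      (29 / 5 * k - 2 * (u * u) - 3) * (k * m) + 1 / 5 * (k * k^-1) * m -
      k * (m * m^-1) by ring.
  rewrite !divff ?gt_eqF// !mulr1.
  (* Shifting by the zero u = 1 splits off a factor h. On [0, 2] the two negative terms of the
     cofactor contribute at most 240 + 176, less than 872. *)
  pose h := u - 1; have [h0 h2] : 0 <= h /\ h <= 2 by rewrite /h; lra.
  have kE : k = 1 + h + h * h / 4 by rewrite /k /h expr2; field.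
  have mE : m = 1 + 4 * h + 2 * (h * h) by rewrite /m /h; ring.
  have uE : u = 1 + h by rewrite /h; ring.
  have -> : (29 / 5 * k - 2 * (u * u) - 3) * (k * m) + 1 / 5 * m - k =
      h * (448 + 1088 * h + h * h * (872 + 189 * h - 60 * (h * h)
        - 22 * (h * (h * h)))) / 80 by rewrite kE mE uE; field.
  have h4 : h * h <= 4 by nra.
  have h8 : h * (h * h) <= 8 by nra.
  apply: divr_ge0; last lra.
  move: h h0 h2 h4 h8 {kE mE uE} => h h0 h2 h4 h8.
  apply: mulr_ge0; first exact: h0.
  apply: addr_ge0; first lra.
  by apply: mulr_ge0; [exact: mulr_ge0|lra].
(* For u > 3, c >= 5/2 and ln (1 + u) >= 2 ln 2 give c ln (1 + u) >= 2 ln (1 + u) + ln 2. *)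
have L4 : ln (2 ^+ 2) <= ln (1 + u) by apply: ler_ln_pos; lra.
rewrite (lnX 2)// in L4.
apply: (@le_trans _ _ (ln (2 * (1 + u) ^+ 2))); last first.
  rewrite lnM ?posrE ?exprn_gt0//; last lra.
  by rewrite (lnX 2); [nra|lra].
have i1 : (2 * (u * u) - 1)^-1 <= 1 by rewrite invf_le1//; lra.
have z0 : 1 <= 2 * (1 + u) ^+ 2 by rewrite expr2; nra.
apply: arch_le_ln => //; first lra.
have : 0 <= (2 * (1 + u) ^+ 2)^-1 by rewrite invr_ge0; lra.
by rewrite expr2; lra.
Qed.

End ArchBounds.

(** * Euclidean geometry up to Ptolemy's inequality *)

Section EuclideanMetric.
Variables (R : realType) (n : nat).
Implicit Types (u v w : 'rV[R]_n) (k : R).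

Definition dot u v : R := \sum_(i < n) u 0 i * v 0 i.

Lemma dotC u v : dot u v = dot v u.
Proof. by apply: eq_bigr => i _; rewrite mulrC. Qed.

Lemma dotDl u v w : dot (u + v) w = dot u w + dot v w.
Proof. by rewrite -big_split; apply: eq_bigr => i _; rewrite mxE mulrDl. Qed.

Lemma dotZl k u v : dot (k *: u) v = k * dot u v.
Proof. by rewrite mulr_sumr; apply: eq_bigr => i _; rewrite mxE mulrA. Qed.

Lemma dotDr u v w : dot u (v + w) = dot u v + dot u w.
Proof. by rewrite dotC dotDl !(dotC u). Qed.

Lemma dotZr k u v : dot u (k *: v) = k * dot u v.
Proof. by rewrite dotC dotZl dotC. Qed.

Lemma dotBB u v : dot (u - v) (u - v) = dot u u - 2 * dot u v + dot v v.
Proof.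
rewrite -(scaleN1r v) !(dotDl, dotDr, dotZl, dotZr) (dotC v u).
by ring.
Qed.

Lemma eucl_norm_ge0 u : 0 <= eucl_norm u.
Proof. exact: sqrtr_ge0. Qed.

Lemma eucl_norm_sqr u : eucl_norm u ^+ 2 = dot u u.
Proof.
rewrite sqr_sqrtr; first by apply: eq_bigr => i _; rewrite expr2.
by apply: sumr_ge0 => i _; exact: sqr_ge0.
Qed.

Lemma eucl_normZ k u : eucl_norm (k *: u) = `|k| * eucl_norm u.
Proof.
apply/eqP; rewrite -(@eqrXn2 _ 2) ?mulr_ge0 ?eucl_norm_ge0//; apply/eqP.
by rewrite exprMn !eucl_norm_sqr real_normK ?num_real// dotZl dotZr mulrA expr2.
Qed.

Lemma eucl_norm_eq0 u : eucl_norm u = 0 -> u = 0.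
Proof.
move=> u0; apply/rowP => i; rewrite mxE; apply/eqP; rewrite -sqrf_eq0.
have /eqP : dot u u = 0 by rewrite -eucl_norm_sqr u0 expr2 mulr0.
rewrite psumr_eq0 => [/allP/(_ i (mem_index_enum i))|j _]; rewrite -expr2//.
exact: sqr_ge0.
Qed.

Lemma eucl_norm0 : eucl_norm (0 : 'rV[R]_n) = 0.
Proof. by rewrite -(scale0r 0) eucl_normZ normr0 mul0r. Qed.

Lemma eucl_norm_gt0 u : u != 0 -> 0 < eucl_norm u.
Proof.
move=> u0; rewrite lt0r eucl_norm_ge0 andbT.
by apply: contra u0 => /eqP/eucl_norm_eq0 ->.
Qed.

Lemma dot_le_norm u v : dot u v <= eucl_norm u * eucl_norm v.
Proof.
have [v0|v0] := eqVneq v 0.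
  by rewrite v0 eucl_norm0 mulr0 -(scale0r (0 : 'rV[R]_n)) dotZr mul0r.
have {}v0 := eucl_norm_gt0 v0.
have u0 := eucl_norm_ge0 u.
rewrite (le_trans (ler_norm _))//.
rewrite -(@ler_pXn2r _ 2) ?nnegrE ?mulr_ge0 ?eucl_norm_ge0//.
rewrite exprMn real_normK ?num_real//.
(* This squared norm is v.v times the Cauchy-Schwarz defect (u.u)(v.v) - (u.v)^2. *)
have : 0 <= dot (dot v v *: u - dot u v *: v) (dot v v *: u - dot u v *: v).
  by rewrite -eucl_norm_sqr sqr_ge0.
rewrite -!scaleNr !(dotDl, dotDr, dotZl, dotZr) (dotC v u) !eucl_norm_sqr.
have vv : 0 < dot v v by rewrite -eucl_norm_sqr exprn_gt0.
move=> h; rewrite -(ler_pM2l vv) -subr_ge0; apply: le_trans h _.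
by rewrite le_eqVlt; apply/orP; left; apply/eqP; ring.
Qed.

Lemma ler_eucl_normD u v : eucl_norm (u + v) <= eucl_norm u + eucl_norm v.
Proof.
rewrite -(@ler_pXn2r _ 2) ?nnegrE ?addr_ge0 ?eucl_norm_ge0//.
rewrite sqrrD !eucl_norm_sqr dotDl !dotDr (dotC v u).
by have := dot_le_norm u v; lra.
Qed.

Lemma eucl_dist_ge0 u v : 0 <= eucl_dist u v.
Proof. exact: eucl_norm_ge0. Qed.

Lemma eucl_distxx u : eucl_dist u u = 0.
Proof. by rewrite /eucl_dist subrr eucl_norm0. Qed.

Lemma eucl_distC u v : eucl_dist u v = eucl_dist v u.
Proof. by rewrite /eucl_dist -opprB -scaleN1r eucl_normZ normrN1 mul1r. Qed.

Lemma eucl_dist_gt0 u v : u != v -> 0 < eucl_dist u v.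
Proof. by rewrite -subr_eq0; exact: eucl_norm_gt0. Qed.

Lemma eucl_dist_triangle u v w :
  eucl_dist u w <= eucl_dist u v + eucl_dist v w.
Proof. by rewrite /eucl_dist -[u - w](subrKA v) ler_eucl_normD. Qed.

(** The distance formula for the inversion u -> u / |u|^2 in the unit sphere. *)
Lemma eucl_norm_inversion u v : u != 0 -> v != 0 ->
  eucl_norm ((dot u u)^-1 *: u - (dot v v)^-1 *: v) =
  eucl_norm (u - v) / (eucl_norm u * eucl_norm v).
Proof.
move=> u0 v0; have {}u0 := eucl_norm_gt0 u0; have {}v0 := eucl_norm_gt0 v0.
apply/eqP; rewrite -(@eqrXn2 _ 2) ?divr_ge0 ?mulr_ge0 ?eucl_norm_ge0//.
have uu : dot u u != 0 by rewrite -eucl_norm_sqr gt_eqF// exprn_gt0.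
have vv : dot v v != 0 by rewrite -eucl_norm_sqr gt_eqF// exprn_gt0.
rewrite expr_div_n exprMn !eucl_norm_sqr !dotBB !(dotZl, dotZr).
by apply/eqP; field; rewrite uu vv.
Qed.

(* Inversion at the fourth point turns Ptolemy's inequality into the triangle
   inequality. *)
Lemma eucl_ptolemy u v w z :
  eucl_dist u v * eucl_dist w z <=
  eucl_dist u w * eucl_dist v z + eucl_dist u z * eucl_dist v w.
Proof.
(* Inversion centred at z requires the other three points to differ from z. *)
have [->|uz] := eqVneq u z.
  by rewrite eucl_distxx mul0r addr0 (eucl_distC z v) (eucl_distC w z) mulrC.
have [->|vz] := eqVneq v z.
  by rewrite eucl_distxx mulr0 add0r (eucl_distC z w).
have [->|wz] := eqVneq w z.
  by rewrite eucl_distxx mulr0 addr_ge0 ?mulr_ge0 ?eucl_dist_ge0.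
have := eucl_dist_triangle ((dot (u - z) (u - z))^-1 *: (u - z))
  ((dot (w - z) (w - z))^-1 *: (w - z)) ((dot (v - z) (v - z))^-1 *: (v - z)).
rewrite {1 2 3}/eucl_dist !eucl_norm_inversion ?subr_eq0//.
have E (a b c : 'rV[R]_n) : a - c - (b - c) = a - b by rewrite opprB addrA subrK.
rewrite !E -/(eucl_dist u v) -/(eucl_dist u z) -/(eucl_dist v z)
  -/(eucl_dist w z) -/(eucl_dist u w) -/(eucl_dist w v) (eucl_distC w v).
move: (eucl_dist_gt0 uz) (eucl_dist_gt0 vz) (eucl_dist_gt0 wz).
move: (eucl_dist u z) (eucl_dist v z) (eucl_dist w z) => a b c a0 b0 c0.
have abc : 0 < a * b * c by rewrite !mulr_gt0.
rewrite -(ler_pM2r abc); congr (_ <= _); field.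
  by rewrite !gt_eqF.
by rewrite !gt_eqF.
Qed.

End EuclideanMetric.

(** * The chordal metric and cross ratios *)

Section ChordalMetric.
Variables (R : realType) (n : nat).
Implicit Types (u v w : 'rV[R]_n) (a b c d x y : mobius_space R n).

(* The weights of the chordal metric cancel in cross ratios, which leaves the
   Euclidean distance, with the distance of a finite point to oo set to 1. *)
Definition flat_dist x y : R :=
  match x, y with
  | Some u, Some v => eucl_dist u v
  | None, None => 0
  | _, _ => 1
  end.

Definition chordal_weight x : R :=
  if x is Some u then (Num.sqrt (1 + eucl_norm u ^+ 2))^-1 else 1.

Lemma chordal_weight_gt0 x : 0 < chordal_weight x.
Proof.
case: x => [u|]//=; rewrite invr_gt0 sqrtr_gt0.
by have := sqr_ge0 (eucl_norm u); lra.
Qed.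

Lemma qE x y : q x y = flat_dist x y * (chordal_weight x * chordal_weight y).
Proof.
by case: x y => [u|] [v|]//=; rewrite ?mul0r ?mul1r ?mulr1// invfM.
Qed.

Lemma flat_distC x y : flat_dist x y = flat_dist y x.
Proof. by case: x y => [u|] [v|]//=; rewrite eucl_distC. Qed.

Lemma flat_dist_ge0 x y : 0 <= flat_dist x y.
Proof. by case: x y => [u|] [v|]//=; rewrite eucl_dist_ge0. Qed.

Lemma flat_distxx x : flat_dist x x = 0.
Proof. by case: x => [u|]//=; rewrite eucl_distxx. Qed.

Lemma flat_dist_gt0 x y : x <> y -> 0 < flat_dist x y.
Proof.
case: x y => [u|] [v|]//= uv.
by apply: eucl_dist_gt0; apply/eqP => uv'; apply: uv; rewrite uv'.
Qed.

(** With exactly one point at oo this is the triangle inequality for the other three. *)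
Lemma flat_ptolemy a b c d :
  flat_dist a b * flat_dist c d <=
  flat_dist a c * flat_dist b d + flat_dist a d * flat_dist b c.
Proof.
case: a b c d => [a|] [b|] [c|] [d|]/=;
  rewrite ?(mul0r, mulr0, mul1r, mulr1, addr0, add0r) ?ler01 ?addr_ge0
    ?mulr_ge0 ?eucl_dist_ge0//.
- exact: eucl_ptolemy.
- by rewrite (eucl_distC b) eucl_dist_triangle.
- by rewrite addrC (eucl_distC b) eucl_dist_triangle.
- by rewrite (eucl_distC a c) eucl_dist_triangle.
- by rewrite (eucl_distC b c) addrC eucl_dist_triangle.
Qed.

(** Each point occurs once in the numerator and once in the denominator, so the weights cancel;
    since they are nonzero, this also covers vanishing denominators. *)
Lemma cross_ratioE a b c d : cross_ratio a b c d =
  flat_dist a c * flat_dist b d / (flat_dist a b * flat_dist c d).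
Proof.
rewrite /cross_ratio !qE.
set wa := chordal_weight a; set wb := chordal_weight b.
set wc := chordal_weight c; set wd := chordal_weight d.
have W : wa * wb * wc * wd != 0.
  by rewrite gt_eqF// !mulr_gt0// chordal_weight_gt0.
rewrite (_ : flat_dist a c * (wa * wc) * (flat_dist b d * (wb * wd)) =
  flat_dist a c * flat_dist b d * (wa * wb * wc * wd)); last by ring.
rewrite (_ : flat_dist a b * (wa * wb) * (flat_dist c d * (wc * wd)) =
  flat_dist a b * flat_dist c d * (wa * wb * wc * wd)); last by ring.
by rewrite -mulf_div divff// mulr1.
Qed.

Lemma cross_ratio_ge0 a b c d : 0 <= cross_ratio a b c d.
Proof. by rewrite cross_ratioE divr_ge0 ?mulr_ge0 ?flat_dist_ge0. Qed.

(** Exchanging a and b exchanges s and t, so t is also a term of the supremum defining [delta]. *)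
Lemma cross_ratio_swap a x b y : cross_ratio b x a y = cross_ratio a y b x.
Proof.
by rewrite !cross_ratioE (flat_distC b a) (flat_distC x y)
  [flat_dist b x * _]mulrC.
Qed.

Section FourPoints.
Variables a b x y : mobius_space R n.
Hypotheses (ax : a <> x) (ay : a <> y) (bx : b <> x) (by' : b <> y).
Local Notation s := (cross_ratio a x b y).
Local Notation t := (cross_ratio a y b x).

(** With P = |a - b| |x - y|, X = |a - x| |b - y| and Z = |a - y| |b - x| one has s = P / X and t =
    P / Z; the three claims come from Z <= P + X, X <= P + Z and P <= X + Z. *)
Lemma cross_ratio_ptolemy :
  [/\ s <= t * (1 + s), t <= s * (1 + t) & s * t <= s + t].
Proof.
rewrite !cross_ratioE (flat_distC y x).
have := flat_ptolemy a b x y; have := flat_ptolemy a x b y.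
have := flat_ptolemy a y b x.
rewrite (flat_distC x b) (flat_distC y b) (flat_distC y x).
have := mulr_gt0 (flat_dist_gt0 ax) (flat_dist_gt0 by').
have := mulr_gt0 (flat_dist_gt0 ay) (flat_dist_gt0 bx).
have := mulr_ge0 (flat_dist_ge0 a b) (flat_dist_ge0 x y).
move: (flat_dist a b * _) (flat_dist a x * _) (flat_dist a y * _) => P X Z.
move=> P0 Z0 X0 ZP XP PXZ.
split; rewrite -subr_ge0.
- have -> : P / Z * (1 + P / X) - P / X = P * (P + X - Z) / (X * Z).
    by field; rewrite !gt_eqF.
  by apply: divr_ge0; apply: mulr_ge0; lra.
- have -> : P / X * (1 + P / Z) - P / Z = P * (P + Z - X) / (X * Z).
    by field; rewrite !gt_eqF.
  by apply: divr_ge0; apply: mulr_ge0; lra.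
- have -> : P / X + P / Z - P / X * (P / Z) = P * (X + Z - P) / (X * Z).
    by field; rewrite !gt_eqF.
  by apply: divr_ge0; apply: mulr_ge0; lra.
Qed.
End FourPoints.

(* The bounds come from [e <= A + C], [e <= B + D] and Ptolemy's inequality, for
   a quadrilateral with vertices a, x, b, y, where A, B, C, D are the sides
   ax, ay, bx, by and e, r the diagonals ab, xy. *)
Lemma quadrilateral_bound (A B C D d e r : R) (u := r / d)
    (Y := e * r / (A * D) * (e * r / (B * C))) :
  0 < d -> d <= A -> d <= B -> d <= C -> d <= D -> 0 <= e -> 0 <= r ->
  e <= A + C -> e <= B + D -> e * r <= A * D + B * C ->
  Y <= 4 * u ^+ 2 /\ (1 <= u -> Y * (2 * u ^+ 2 - 1) <= 4 * u ^+ 4).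
Proof.
move=> d0 dA dB dC dD e0 r0 eAC eBD eABCD.
have rE : r = u * d by rewrite /u divfK// gt_eqF.
have u0 : 0 <= u by rewrite divr_ge0// ltW.
have [A0 B0 C0 D0] : [/\ 0 < A, 0 < B, 0 < C & 0 < D] by split; lra.
pose X := A * D; pose Z := B * C.
have X0 : 0 < X by rewrite mulr_gt0.
have Z0 : 0 < Z by rewrite mulr_gt0.
have YE : Y * (X * Z) = (e * r) ^+ 2.
  by rewrite /Y /X /Z; field; rewrite !gt_eqF.
have Y0 : 0 <= Y by rewrite !mulr_ge0 ?invr_ge0 ?mulr_ge0// ltW.
have ee : e ^+ 2 <= (A + C) * (B + D) by rewrite expr2 ler_pM.
split.
  rewrite -(ler_pM2r (mulr_gt0 X0 Z0)) YE rE.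
  (* Since d <= A and d <= C, 1/A + 1/C <= 2/d; likewise for B and D. *)
  have h1 : d * (A + C) <= 2 * (A * C) by nra.
  have h2 : d * (B + D) <= 2 * (B * D) by nra.
  have h3 : d * (A + C) * (d * (B + D)) <= 2 * (A * C) * (2 * (B * D)).
    by apply: ler_pM => //; apply: mulr_ge0; lra.
  have h4 : e ^+ 2 * d ^+ 2 <= 4 * (X * Z).
    apply: (@le_trans _ _ ((A + C) * (B + D) * d ^+ 2)).
      by rewrite ler_wpM2r ?sqr_ge0.
    by rewrite /X /Z; move: h3; rewrite expr2; lra.
  have -> : (e * (u * d)) ^+ 2 = u ^+ 2 * (e ^+ 2 * d ^+ 2) by ring.
  have -> : 4 * u ^+ 2 * (X * Z) = u ^+ 2 * (4 * (X * Z)) by ring.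
  by rewrite ler_wpM2l ?sqr_ge0.
move=> u1.
(* The bounds on Y involve X and Z only through their sum and product, so the two may be ordered. *)
pose m := Num.min X Z; pose M := Num.max X Z.
have [m0 M0 mM] : [/\ 0 < m, 0 < M & m <= M].
  by rewrite /m /M lt_min lt_max X0 Z0 ge_min le_max !lexx orbT.
have mMM : m * M = X * Z by rewrite /m /M; case: leP => _; rewrite // mulrC.
have mMD : m + M = X + Z by rewrite /m /M; case: leP => _; rewrite // addrC.
have dm : d * d <= m by rewrite le_min; apply/andP; split; apply: ler_pM; lra.
have AB : d * d <= A * B by apply: ler_pM; lra.
have CD : d * d <= C * D by apply: ler_pM; lra.
have dd : 0 < d * d by apply: mulr_gt0.
have Ym : Y * (m * M) <= (m + M) ^+ 2.
  rewrite mMM mMD YE ler_pXn2r// nnegrE; last by lra.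
  by apply: mulr_ge0.
(* Here (A + C) (B + D) = m + M + A B + C D, and (A B - d^2) (C D - d^2) >= 0 bounds A B + C D by m
   M / d^2 + d^2. *)
have YM : Y * M <= 2 * u ^+ 2 * (m + M).
  rewrite -(ler_pM2l m0) mulrCA mMM YE rE.
  have -> : (e * (u * d)) ^+ 2 = u ^+ 2 * (e ^+ 2 * (d * d)) by ring.
  have -> : m * (2 * u ^+ 2 * (m + M)) = u ^+ 2 * (2 * (m * (m + M))) by ring.
  rewrite ler_wpM2l ?sqr_ge0//.
  apply: (@le_trans _ _ ((A + C) * (B + D) * (d * d))).
    by rewrite ler_wpM2r// ltW.
  have -> : (A + C) * (B + D) * (d * d) =
      (m + M) * (d * d) + (A * B * (d * d) + C * D * (d * d)).
    by rewrite mMD /X /Z; ring.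
  have h1 : (m + M) * (d * d) <= m * (m + M) by rewrite mulrC ler_wpM2r//; lra.
  have h2 : A * B * (d * d) + C * D * (d * d) <= m * M + (d * d) * (d * d).
    have : 0 <= (A * B - d * d) * (C * D - d * d) by apply: mulr_ge0; lra.
    by rewrite mMM /X /Z; lra.
  have h3 : (d * d) * (d * d) <= m * m by apply: ler_pM; lra.
  by lra.
pose N := 2 * u ^+ 2 - 1.
have N1 : 1 <= N by rewrite /N expr2; nra.
have uN : 2 * u ^+ 2 = N + 1 by rewrite /N; ring.
have -> : 4 * u ^+ 4 = (N + 1) ^+ 2 by rewrite -uN; ring.
rewrite -/N; rewrite uN in YM.
(* [Ym] serves when m and M are comparable, [YM] when M is much larger. They meet at M = N m, where
   both bound Y by (N + 1)^2 / N. *)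
have [MN|MN] := leP M (N * m).
  rewrite -(ler_pM2r (mulr_gt0 m0 M0)).
  have -> : Y * N * (m * M) = N * (Y * (m * M)) by ring.
  apply: (@le_trans _ _ (N * (m + M) ^+ 2)); first by rewrite ler_wpM2l//; lra.
  rewrite -subr_ge0.
  have -> : (N + 1) ^+ 2 * (m * M) - N * (m + M) ^+ 2 =
    (N * m - M) * (N * M - m) by ring.
  by apply: mulr_ge0; nra.
rewrite -(ler_pM2r M0).
have -> : Y * N * M = N * (Y * M) by ring.
apply: (@le_trans _ _ (N * ((N + 1) * (m + M)))); first by rewrite ler_wpM2l//; lra.
rewrite -subr_ge0.
have -> : (N + 1) ^+ 2 * M - N * ((N + 1) * (m + M)) = (N + 1) * (M - N * m) by ring.
by apply: mulr_ge0; lra.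
Qed.

End ChordalMetric.

(** * Neighbourhoods in Euclidean terms and bounds on the chordal metric *)

Section ChordalTopology.
Variables (R : realType) (n : nat).
Implicit Types (u v w : 'rV[R]_n) (a b c d x y : mobius_space R n).

Lemma mx_norm_le_eucl u : `|u| <= eucl_norm u.
Proof.
have [u0|/mx_norm_neq0[[i j]]] := eqVneq `|u| 0; first by rewrite u0 eucl_norm_ge0.
rewrite -[mx_norm u]/`|u| => -> /=; rewrite ord1.
rewrite -(@ler_pXn2r _ 2) ?nnegrE ?eucl_norm_ge0// eucl_norm_sqr.
rewrite /dot (bigD1 j)//= real_normK ?num_real// expr2 lerDl.
by apply: sumr_ge0 => k _; rewrite -expr2 sqr_ge0.
Qed.

Lemma eucl_norm_le_mx u : eucl_norm u ^+ 2 <= n%:R * `|u| ^+ 2.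
Proof.
rewrite eucl_norm_sqr /dot.
apply: (@le_trans _ _ (\sum_(i < n) `|u| ^+ 2)); last first.
  by rewrite sumr_const card_ord mulr_natl.
apply: ler_sum => i _.
rewrite -expr2 -(real_normK (num_real (u 0 i))) lerXn2r ?nnegrE//.
by rewrite [leRHS]/Num.norm/= mx_normrE; apply/bigmax_geP; right; exists (0, i).
Qed.

Lemma some_ball_subset u (U : set (mobius_space R n)) : nbhs (Some u : mobius_space R n) U ->
  exists2 e : R, 0 < e & forall v, eucl_dist u v < e -> U (Some v).
Proof.
move=> /nbhs_ballP[e /= e0 eU]; exists e => // v uv; apply: eU.
by rewrite -ball_normE/=; apply: le_lt_trans uv; exact: mx_norm_le_eucl.
Qed.

Lemma none_ball_subset (U : set (mobius_space R n)) : nbhs (None : mobius_space R n) U ->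
  exists2 M : R, 0 < M & forall v, M < eucl_norm v -> U (Some v).
Proof.
move=> [K [/= cK _] KU].
have [M [Mr MK]] := compact_bounded cK.
pose N := Num.max 1 (M + 1).
have N1 : 1 <= N by rewrite le_max lexx.
have MN : M < N by rewrite lt_max ltrDl ltr01 orbT.
have n0 : 0 <= n%:R :> R by rewrite ler0n.
(* The factor n + 1 stands in for sqrt n, as n <= (n + 1)^2. *)
exists ((n%:R + 1) * N); first by apply: mulr_gt0; lra.
move=> v vN; apply: KU; left; exists v => // Kv.
have := MK _ MN _ Kv => /= vN'.
move: vN; apply/negP; rewrite -leNgt.
rewrite -(@ler_pXn2r _ 2) ?nnegrE ?eucl_norm_ge0//; last by apply: mulr_ge0; lra.
apply: (le_trans (eucl_norm_le_mx v)).
apply: (@le_trans _ _ (n%:R * N ^+ 2)).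
  by rewrite ler_wpM2l// lerXn2r ?nnegrE//; lra.
rewrite exprMn ler_wpM2r ?sqr_ge0// expr2.
by have := sqr_ge0 (n%:R : R); rewrite expr2; lra.
Qed.

Lemma q_ge0 x y : 0 <= q x y.
Proof. by rewrite qE mulr_ge0 ?flat_dist_ge0// mulr_ge0// ltW// chordal_weight_gt0. Qed.

Lemma sqrt1D_sqr u : Num.sqrt (1 + eucl_norm u ^+ 2) ^+ 2 = 1 + eucl_norm u ^+ 2.
Proof. by rewrite sqr_sqrtr// addr_ge0// sqr_ge0. Qed.

Lemma sqrt1D_ge1 u : 1 <= Num.sqrt (1 + eucl_norm u ^+ 2).
Proof.
by rewrite -(@ler_pXn2r _ 2) ?nnegrE ?sqrtr_ge0// expr1n sqrt1D_sqr lerDl sqr_ge0.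
Qed.

Lemma q_le1 x y : q x y <= 1.
Proof.
have w := sqrt1D_ge1.
case: x y => [u|] [v|]//=; last 2 first.
- by rewrite ler_pdivrMr ?mul1r// (lt_le_trans ltr01).
- by rewrite ler_pdivrMr ?mul1r// (lt_le_trans ltr01).
- rewrite ler_pdivrMr; last by rewrite mulr_gt0// (lt_le_trans ltr01).
  rewrite mul1r -(@ler_pXn2r _ 2) ?nnegrE ?eucl_dist_ge0 ?mulr_ge0 ?sqrtr_ge0//.
  rewrite exprMn !sqrt1D_sqr.
  apply: (@le_trans _ _ ((eucl_norm u + eucl_norm v) ^+ 2)).
    rewrite lerXn2r ?nnegrE ?eucl_dist_ge0 ?addr_ge0 ?eucl_norm_ge0//.
    rewrite /eucl_dist (le_trans (ler_eucl_normD _ _))// -scaleN1r eucl_normZ.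
    by rewrite normrN1 mul1r.
  rewrite -subr_ge0.
  have -> : (1 + eucl_norm u ^+ 2) * (1 + eucl_norm v ^+ 2) -
    (eucl_norm u + eucl_norm v) ^+ 2 = (1 - eucl_norm u * eucl_norm v) ^+ 2 by ring.
  exact: sqr_ge0.
Qed.

Lemma q_le_eucl u v : q (Some u : mobius_space R n) (Some v) <= eucl_dist u v.
Proof.
have w := sqrt1D_ge1.
rewrite /q ler_pdivrMr; last by rewrite mulr_gt0// (lt_le_trans ltr01).
by rewrite ler_peMr ?eucl_dist_ge0// mulr_ege1.
Qed.

End ChordalTopology.

(** * Suprema over the boundary, the comparison of [delta] with [rho], and rays leaving a domain *)

Section Comparison.
Variables (R : realType) (n : nat).
Implicit Types (u v w : 'rV[R]_n) (a b c d x y : mobius_space R n).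
Implicit Type G : set (mobius_space R n).

Lemma boundary_notin G a : open G -> boundary G a -> ~ G a.
Proof. by move=> oG [_ aG] Ga; apply: aG; move: oG; rewrite openE; apply. Qed.

(** This gap between x and the complement of G keeps the denominators of the cross ratios away from
    0. *)
Lemma q_ge_outside G x : open G -> G x ->
  exists2 e : R, 0 < e & forall a, ~ G a -> e <= q a x.
Proof.
rewrite openE => oG Gx; have := oG _ Gx; case: x Gx => [u|] Gx.
  move=> /some_ball_subset[e e0 eG].
  set W := Num.sqrt (1 + eucl_norm u ^+ 2).
  have W1 : 1 <= W := sqrt1D_ge1 u.
  have u0 := eucl_norm_ge0 u.
  (* For t = |v - u| >= e, sqrt (1 + |v|^2) <= 1 + |u| + t, and t / (1 + |u| + t) increases with
     t. *)
  exists (e / ((1 + eucl_norm u + e) * W)).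
    by apply: divr_gt0 => //; apply: mulr_gt0; lra.
  case=> [v|] Ga /=; rewrite -/W; last first.
    rewrite invfM mulrA ler_wpM2r ?invr_ge0//; first lra.
    by rewrite ler_pdivrMr; lra.
  have ed : e <= eucl_dist v u.
    by rewrite eucl_distC leNgt; apply/negP => /eG.
  rewrite !invfM !mulrA ler_wpM2r ?invr_ge0//; first lra.
  have Wv1 := sqrt1D_ge1 v.
  have Wv : Num.sqrt (1 + eucl_norm v ^+ 2) <= 1 + eucl_norm u + eucl_dist v u.
    apply: (@le_trans _ _ (1 + eucl_norm v)).
      have v0 := eucl_norm_ge0 v.
      rewrite -(@ler_pXn2r _ 2) ?nnegrE ?sqrtr_ge0 ?addr_ge0// sqrt1D_sqr.
      by rewrite sqrrD expr1n; lra.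
    have := ler_eucl_normD (v - u) u; rewrite subrK /eucl_dist.
    by lra.
  rewrite ler_pdivlMr; last lra.
  rewrite mulrAC ler_pdivrMr; last lra.
  apply: (@le_trans _ _ (e * (1 + eucl_norm u + eucl_dist v u))).
    by rewrite ler_wpM2l// ltW.
  by have := eucl_dist_ge0 v u; nra.
move=> /none_ball_subset[M M0 MG]; exists (1 + M)^-1; first by rewrite invr_gt0; lra.
case=> [v|] // Ga /=.
have s0 := lt_le_trans ltr01 (sqrt1D_ge1 v).
have M10 : 0 < 1 + M by lra.
rewrite mul1r lef_pV2 ?posrE//.
have vM : eucl_norm v <= M by rewrite leNgt; apply/negP => /MG.
have v0 := eucl_norm_ge0 v.
rewrite -(@ler_pXn2r _ 2) ?nnegrE ?sqrtr_ge0//; last lra.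
rewrite sqrt1D_sqr sqrrD expr1n.
have : eucl_norm v ^+ 2 <= M ^+ 2 by rewrite lerXn2r ?nnegrE//; lra.
by lra.
Qed.

Section Bounds.
Variables (G : set (mobius_space R n)) (x y : mobius_space R n).
Hypotheses (oG : open G) (Gx : G x) (Gy : G y).

(** Makes the sets defining [delta] and [rho] bounded above, so that each [sup] dominates its
    members. The numerator is controlled by q <= 1. *)
Lemma cross_ratio_bounded :
  exists2 K : R, 0 <= K & forall a b, boundary G a -> boundary G b ->
  cross_ratio a x b y <= K.
Proof.
have [e e0 eG] := q_ge_outside oG Gx.
have [f f0 fG] := q_ge_outside oG Gy.
have ef : 0 < e * f by rewrite mulr_gt0.
exists (e * f)^-1; first by rewrite invr_ge0 ltW.
move=> a b /(boundary_notin oG)/eG ea /(boundary_notin oG)/fG fb.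
have eqf : e * f <= q a x * q b y by apply: ler_pM => //; exact: ltW.
rewrite /cross_ratio -[leRHS]mul1r ler_pM ?invr_ge0 ?mulr_ge0 ?q_ge0//.
  by rewrite mulr_ile1 ?q_ge0 ?q_le1.
by rewrite lef_pV2// posrE (lt_le_trans ef).
Qed.
End Bounds.

Section Metrics.
Variables (G : set (mobius_space R n)) (x y : mobius_space R n).
Hypotheses (oG : open G) (Gx : G x) (Gy : G y).
Local Notation s a b := (cross_ratio a x b y).
Local Notation t a b := (cross_ratio a y b x).

Lemma le_delta a b : boundary G a -> boundary G b ->
  ln (1 + s a b) <= delta G x y.
Proof.
move=> Ga Gb; apply: ub_le_sup; last by exists a => //; exists b.
have [K K0 KG] := cross_ratio_bounded oG Gx Gy.
exists (ln (1 + K)) => _ [c Gc [d Gd <-]].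
have c0 := cross_ratio_ge0 c x d y.
by apply: ler_ln_pos; [lra|have := KG c d Gc Gd; lra].
Qed.

Lemma le_rho a b : boundary G a -> boundary G b ->
  arch (1 + s a b * t a b / 2) <= rho G x y.
Proof.
move=> Ga Gb; apply: ub_le_sup; last by exists a => //; exists b.
have [K K0 KG] := cross_ratio_bounded oG Gx Gy.
have [L L0 LG] := cross_ratio_bounded oG Gy Gx.
exists (arch (1 + K * L / 2)) => _ [c Gc [d Gd <-]].
have c0 := cross_ratio_ge0 c x d y.
have d0 := cross_ratio_ge0 c y d x.
have cd0 := mulr_ge0 c0 d0.
apply: arch_mono; first lra.
have : s c d * t c d <= K * L by apply: ler_pM => //; [exact: KG|exact: LG].
by lra.
Qed.

Hypothesis G0 : boundary G !=set0.

Lemma delta_le (M : R) : (forall a b, boundary G a -> boundary G b ->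
  ln (1 + s a b) <= M) -> delta G x y <= M.
Proof.
case: G0 => a Ga h; apply: ge_sup.
  by exists (ln (1 + s a a)); exists a => //; exists a.
by move=> _ [c Gc [d Gd <-]]; exact: h.
Qed.

Lemma rho_le (M : R) : (forall a b, boundary G a -> boundary G b ->
  arch (1 + s a b * t a b / 2) <= M) -> rho G x y <= M.
Proof.
case: G0 => a Ga h; apply: ge_sup.
  by exists (arch (1 + s a a * t a a / 2)); exists a => //; exists a.
by move=> _ [c Gc [d Gd <-]]; exact: h.
Qed.

Lemma cross_ratio_ptolemy_boundary a b : boundary G a -> boundary G b ->
  [/\ s a b <= t a b * (1 + s a b), t a b <= s a b * (1 + t a b) &
      s a b * t a b <= s a b + t a b].
Proof.
move=> /(boundary_notin oG) Ga /(boundary_notin oG) Gb.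
by apply: cross_ratio_ptolemy => E; [apply: Ga|apply: Ga|apply: Gb|apply: Gb];
  rewrite E.
Qed.

Lemma delta_le_rho : delta G x y <= rho G x y.
Proof.
apply: delta_le => a b Ga Gb; apply: le_trans (le_rho Ga Gb).
have [st _ _] := cross_ratio_ptolemy_boundary Ga Gb.
exact: (ln_le_arch_prod (cross_ratio_ge0 _ _ _ _)).
Qed.

Lemma rho_le_delta : rho G x y <= arch 3 / ln 3 * delta G x y.
Proof.
have c0 : 0 <= arch 3 / ln 3 :> R.
  have /andP[h _] := arch3_ln3 R; have h3 := ln3_gt0 R.
  by rewrite divr_ge0// ltW// (lt_le_trans h3).
apply: rho_le => a b Ga Gb.
have s0 := cross_ratio_ge0 a x b y; have t0 := cross_ratio_ge0 a y b x.
have [_ _ st] := cross_ratio_ptolemy_boundary Ga Gb.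
have [ts|/ltW ts] := leP (t a b) (s a b).
  by apply: (le_trans (arch_prod_le t0 ts st)); rewrite ler_wpM2l// le_delta.
(* Here t is the larger ratio; it is the value of s at the exchanged pair (b, a), so [delta] bounds
   ln (1 + t) as well. *)
rewrite [s a b * _]mulrC; rewrite mulrC addrC in st.
apply: (le_trans (arch_prod_le s0 ts st)); rewrite ler_wpM2l//.
by rewrite -cross_ratio_swap le_delta.
Qed.
End Metrics.

(** If the ray misses the boundary, its part in G is relatively open and closed, so the whole ray
    lies in G; then G is unbounded and oo is a boundary point. *)
Lemma ray_meets_boundary G u w : open G -> finite_domain G -> G (Some u) ->
  w != 0 -> exists2 b, boundary G b &
  b = None \/ exists2 t : R, 0 <= t & b = Some (u + t *: w).
Proof.
move=> oG fG Gu w0; apply: contrapT => noB.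
have GN : ~ G None by move=> /fG[].
pose phi (t : R) : mobius_space R n := Some (u + t *: w).
have cphi : continuous phi.
  move=> t; apply: (@continuous_comp R 'rV[R]_n (one_point_compactification 'rV[R]_n)
    (fun t : R => u + t *: w) Some).
    by apply: cvgD; [exact: cvg_cst|apply: cvgZr_tmp; exact: cvg_id].
  exact: one_point_compactification_some_continuous.
have cray : connected (phi @` [set` `[0, +oo[]).
  apply: connected_continuous_connected; last exact: continuous_subspaceT.
  by apply/connected_intervalP; exact: interval_is_interval.
have rayG : phi @` [set` `[0, +oo[] `&` G = phi @` [set` `[0, +oo[].
  apply: cray.
  - by exists (Some u); split=> //; exists 0; rewrite /= ?in_itv/= ?lexx// /phi scale0r addr0.
  - by exists G.
  - exists (closure G); first exact: closed_closure.
    apply/seteqP; split=> z [rz Gz]; split=> //; first exact: subset_closure.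
    apply: contrapT => nGz; apply: noB; exists z.
      by split=> // /interior_subset.
    by right; case: rz => t; rewrite /= in_itv/= andbT => t0 <-; exists t.
apply: noB; exists None; last by left.
split; last by move=> /interior_subset.
move=> U /none_ball_subset[M M0 MU].
have w1 := eucl_norm_gt0 w0.
(* This t makes |u + t w| >= t |w| - |u| = M + 1. *)
pose t := (M + 1 + eucl_norm u) / eucl_norm w.
have u0 := eucl_norm_ge0 u.
have t0 : 0 <= t by apply: divr_ge0; lra.
exists (phi t); split.
  have : (phi @` [set` `[0, +oo[]) (phi t) by exists t; rewrite //= in_itv/= t0.
  by rewrite -rayG => -[].
apply: MU.
have := ler_eucl_normD (u + t *: w) (-1 *: u).
rewrite scaleN1r addrAC subrr add0r -scaleN1r !eucl_normZ normrN1 ger0_norm//.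
rewrite /t divfK ?gt_eqF//; lra.
Qed.

End Comparison.

Lemma card_ge2P (T : pointedType) (A : set T) :
  (`I_2 #<= A)%card <-> exists a b, [/\ A a, A b & a <> b].
Proof.
split=> [|[a [b [Aa Ab ab]]]].
  move=> /pcard_leP/unsquash f; exists (f 0%N), (f 1%N); split.
  - exact: funS.
  - exact: funS.
  - by move=> /(@inj _ _ _ f); rewrite !inE => /(_ isT isT).
pose f (z : T) : nat := if pselect (z = a) then 0 else 1.
apply: (@card_le_trans _ _ _ (f @` A)); last exact: card_image_le.
apply: subset_card_le => -[|[|//]] _.
  by exists a; rewrite /f//; case: pselect.
by exists b; rewrite /f//; case: pselect => // ba; rewrite ba in ab.
Qed.

(** * Domains in R^n and the metric j *)

Section FiniteDomain.
Variables (R : realType) (n : nat).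
Implicit Types (u v w : 'rV[R]_n) (a b c d x y : mobius_space R n).
Variable G : set (mobius_space R n).
Hypotheses (oG : open G) (fG : finite_domain G).

Lemma bdist_le u w : boundary G (Some w) -> bdist G u <= eucl_dist u w.
Proof.
move=> Gw; apply: ge_inf; last by exists w.
by exists 0 => _ [v _ <-]; exact: eucl_dist_ge0.
Qed.

Lemma bdist_ge u w (e : R) : boundary G (Some w) ->
  (forall v, boundary G (Some v) -> e <= eucl_dist u v) -> e <= bdist G u.
Proof.
move=> Gw h; apply: lb_le_inf; first by exists (eucl_dist u w), w.
by move=> _ [v Gv <-]; exact: h.
Qed.

Lemma bdist_gt0 u w : boundary G (Some w) -> G (Some u) -> 0 < bdist G u.
Proof.
move=> Gw Gu; have [e e0 eG] := q_ge_outside oG Gu.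
apply: (lt_le_trans e0); apply: (bdist_ge Gw) => v /(boundary_notin oG)/eG ev.
by rewrite eucl_distC (le_trans ev)// q_le_eucl.
Qed.

(* The boundary point is found on the ray from v pointing away from w. *)
Lemma boundary_beyond v w : G (Some v) -> boundary G (Some w) ->
  exists2 b, boundary G b & flat_dist b (Some v) <= flat_dist (Some w) b.
Proof.
move=> Gv Gw; have vw : v - w != 0.
  rewrite subr_eq0; apply/eqP => vw; apply: (boundary_notin oG Gw).
  by rewrite -vw.
have [b Gb bE] := ray_meets_boundary oG fG Gv vw; exists b => //.
case: bE Gb => [->//|[t t0 ->]] _ /=.
rewrite [leRHS]eucl_distC /eucl_dist addrAC subrr add0r.
have -> : v + t *: (v - w) - w = (1 + t) *: (v - w).
  by rewrite scalerDl scale1r addrAC.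
rewrite !eucl_normZ !ger0_norm//; last lra.
by rewrite ler_wpM2r ?eucl_norm_ge0//; lra.
Qed.

(** For b as in [boundary_beyond], the cross ratio is |u - v| / |u - w| times the factor |w - b| /
    |b - v| >= 1, read as 1 for b = oo. *)
Lemma ln_le_delta u v w : G (Some u) -> G (Some v) -> boundary G (Some w) ->
  ln (1 + eucl_dist u v / eucl_dist u w) <= delta G (Some u) (Some v).
Proof.
move=> Gu Gv Gw; have [b Gb bw] := boundary_beyond Gv Gw.
apply: le_trans (le_delta oG Gu Gv Gw Gb).
have bv : b <> Some v by move=> bv; apply: (boundary_notin oG Gb); rewrite bv.
have wu : Some w <> Some u :> mobius_space R n.
  by move=> wu; apply: (boundary_notin oG Gw); rewrite wu.
have bv0 := flat_dist_gt0 bv; have wu0 := flat_dist_gt0 wu.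
have uv0 := eucl_dist_ge0 u v.
have h : eucl_dist u v / eucl_dist u w <= cross_ratio (Some w) (Some u) b (Some v).
  rewrite cross_ratioE (eucl_distC u w).
  have -> : flat_dist (Some w) b * flat_dist (Some u) (Some v) /
    (flat_dist (Some w) (Some u) * flat_dist b (Some v)) =
    eucl_dist u v / eucl_dist w u * (flat_dist (Some w) b / flat_dist b (Some v)).
    by rewrite [flat_dist (Some w) b * _]mulrC invfM mulrACA.
  rewrite ler_peMr ?divr_ge0 ?eucl_dist_ge0//.
  by rewrite ler_pdivlMr// mul1r.
apply: ler_ln_pos; last by rewrite lerD2l.
by rewrite ltr_pwDl// divr_ge0// eucl_dist_ge0.
Qed.

Lemma delta_ge0 x y : boundary G !=set0 -> G x -> G y -> 0 <= delta G x y.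
Proof.
move=> [a Ga] Gx Gy; apply: le_trans (le_delta oG Gx Gy Ga Ga).
by rewrite ln_ge0// lerDl cross_ratio_ge0.
Qed.

Lemma deltaC_ge u v w : G (Some u) -> G (Some v) -> boundary G (Some w) ->
  ln (1 + eucl_dist u v / eucl_dist v w) <= delta G (Some u) (Some v).
Proof.
move=> Gu Gv Gw; rewrite (eucl_distC u v).
apply: (le_trans (ln_le_delta Gv Gu Gw)).
apply: delta_le => [|a b Ga Gb]; first by exists (Some w).
by rewrite -cross_ratio_swap; apply: le_delta.
Qed.

(** The bounds at single boundary points are solved for the distance to that point, which allows
    passing to the infimum. *)
Lemma jmetric_le_delta x y w : boundary G (Some w) -> G x -> G y ->
  jmetric G x y <= delta G x y.
Proof.
move=> Gw Gx Gy; have d0 : 0 <= delta G x y.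
  by apply: delta_ge0 => //; exists (Some w).
have [u _ xu] := fG Gx; have [v _ yv] := fG Gy;
subst x y => /=; rename Gx into Gu; rename Gy into Gv.
have [uv|uv] := eqVneq u v.
  by move: d0; rewrite uv eucl_distxx mul0r addr0 ln1.
have r0 := eucl_dist_gt0 uv; set r := eucl_dist u v in r0 *.
set D := delta _ _ _ in d0 *.
(* For z >= 0, ln (1 + z) <= D gives z <= E, so all distances from u and v to the finite boundary
   are at least r / E. *)
pose E := expR D - 1.
have lnE (z : R) : 0 <= z -> ln (1 + z) <= D -> z <= E.
  move=> z0; rewrite -ler_expR lnK ?posrE; last lra.
  by rewrite /E; lra.
have away (z z' : 'rV[R]_n) : 0 < eucl_dist z z' -> ln (1 + r / eucl_dist z z') <= D ->
    0 < E /\ r / E <= eucl_dist z z'.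
  move=> zz' h; have rz : 0 < r / eucl_dist z z' by rewrite divr_gt0.
  have := lnE _ (ltW rz) h => rE; have E0 := lt_le_trans rz rE; split=> //.
  by rewrite ler_pdivrMr// mulrC -ler_pdivrMr.
have pos z z' : G (Some z) -> boundary G (Some z') -> 0 < eucl_dist z z'.
  move=> Gz Gz'; apply: eucl_dist_gt0; apply/eqP => zz'.
  by apply: (boundary_notin oG Gz'); rewrite -zz'.
have [E0 _] := away _ _ (pos _ _ Gu Gw) (ln_le_delta Gu Gv Gw).
have bu : r / E <= bdist G u.
  apply: (bdist_ge Gw) => z Gz.
  by have [] := away _ _ (pos _ _ Gu Gz) (ln_le_delta Gu Gv Gz).
have bv : r / E <= bdist G v.
  apply: (bdist_ge Gw) => z Gz.
  by have [] := away _ _ (pos _ _ Gv Gz) (deltaC_ge Gu Gv Gz).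
have rE0 : 0 < r / E by rewrite divr_gt0.
set m := Num.min _ _; have rm : r / E <= m by rewrite /m le_min bu bv.
have m0 := lt_le_trans rE0 rm.
rewrite -[leRHS]expRK; apply: ler_ln_pos; first by rewrite ltr_pwDl// divr_ge0// ltW.
suff : r / m <= E by rewrite /E; lra.
by rewrite ler_pdivrMr// mulrC -ler_pdivrMr.
Qed.

Lemma rho_le_jmetric x y w : boundary G (Some w) -> G x -> G y ->
  rho G x y <= arch 3 / ln 2 * jmetric G x y.
Proof.
move=> Gw Gx Gy; have [u _ xu] := fG Gx; have [v _ yv] := fG Gy;
subst x y; rename Gx into Gu; rename Gy into Gv.
apply: rho_le => [|a b Ga Gb]; first by exists (Some w).
set d := Num.min (bdist G u) (bdist G v).
have d0 : 0 < d by rewrite lt_min (bdist_gt0 Gw Gu) (bdist_gt0 Gw Gv).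
have du z : boundary G (Some z) -> d <= eucl_dist z u.
  by move=> Gz; rewrite eucl_distC (le_trans _ (bdist_le _ Gz))// ge_min lexx.
have dv z : boundary G (Some z) -> d <= eucl_dist z v.
  by move=> Gz; rewrite eucl_distC (le_trans _ (bdist_le _ Gz))// ge_min lexx orbT.
have r0 := eucl_dist_ge0 u v.
rewrite [jmetric _ _ _]/(ln _) -/d.
set Y := cross_ratio _ _ _ _ * _; have Y0 : 0 <= Y by rewrite mulr_ge0 ?cross_ratio_ge0.
have uu0 : 0 <= eucl_dist u v / d by rewrite divr_ge0// ltW.
suff [h1 h2] : Y <= 4 * (eucl_dist u v / d) ^+ 2 /\
    (1 <= eucl_dist u v / d ->
     Y * (2 * (eucl_dist u v / d) ^+ 2 - 1) <= 4 * (eucl_dist u v / d) ^+ 4).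
  exact: arch_le_jbound.
(* If exactly one of a, b is oo, only the distances p, p' of the other one to u and v remain in Y,
   whence Y <= (|u - v| / d)^2. *)
have one_infinite p p' : d <= p -> d <= p' ->
    Y = eucl_dist u v / p * (eucl_dist u v / p') ->
  Y <= 4 * (eucl_dist u v / d) ^+ 2 /\
    (1 <= eucl_dist u v / d ->
     Y * (2 * (eucl_dist u v / d) ^+ 2 - 1) <= 4 * (eucl_dist u v / d) ^+ 4).
  move=> dp dp' YE.
  have Yle : Y <= (eucl_dist u v / d) ^+ 2.
    have q_le z : d <= z -> eucl_dist u v / z <= eucl_dist u v / d.
      by move=> dz; rewrite ler_wpM2l// lef_pV2// posrE (lt_le_trans d0).
    have q_ge0 z : d <= z -> 0 <= eucl_dist u v / z.
      by move=> dz; rewrite divr_ge0// (le_trans (ltW d0)).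
    by rewrite YE expr2 ler_pM ?q_le ?q_ge0.
  move: (eucl_dist u v / d) uu0 Yle => k k0 Yk.
  have kk := sqr_ge0 k.
  split=> [|k1]; first lra.
  have k1' : 1 <= k ^+ 2 by rewrite exprn_ege1.
  have -> : k ^+ 4 = k ^+ 2 * k ^+ 2 by rewrite -exprD.
  by nra.
case: a Ga @Y Y0 one_infinite => [a|] Ga; case: b Gb => [b|] Gb Y Y0 one_infinite.
- rewrite /Y !cross_ratioE /= (eucl_distC v u).
  apply: quadrilateral_bound => //; rewrite ?du ?dv ?eucl_dist_ge0//.
  + by rewrite (eucl_distC b) eucl_dist_triangle.
  + by rewrite (eucl_distC b) eucl_dist_triangle.
  + by rewrite (le_trans (eucl_ptolemy a b u v))// (eucl_distC b v) (eucl_distC b u) addrC.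
- apply: (one_infinite _ _ (du _ Ga) (dv _ Ga)).
  by rewrite /Y !cross_ratioE /= !mul1r !mulr1 (eucl_distC v u).
- apply: (one_infinite _ _ (dv _ Gb) (du _ Gb)).
  by rewrite /Y !cross_ratioE /= !mul1r (eucl_distC v u).
- have -> : Y = 0 by rewrite /Y !cross_ratioE /= !mul0r.
  split=> [|_]; first by rewrite mulr_ge0// sqr_ge0.
  by rewrite mul0r mulr_ge0// exprn_ge0.
Qed.

End FiniteDomain.

(** * The punctured space and its metrics *)

Section PuncturedSpace.
Variables (R : realType) (n : nat).
Implicit Types (u v w : 'rV[R]_n) (a b c d x y : mobius_space R n).

Definition punctured : set (mobius_space R n) :=
  Some @` [set u : 'rV[R]_n | u != 0].

Local Notation e := (delta_mx (0 : 'I_1) : 'I_n -> 'rV[R]_n).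

Lemma eucl_norm_delta i : eucl_norm (e i) = 1.
Proof.
apply/eqP; rewrite -(@eqrXn2 _ 2) ?eucl_norm_ge0// eucl_norm_sqr expr1n.
rewrite /dot (bigD1 i)//= big1 ?addr0 => [|j ji]; rewrite !mxE ?eqxx ?mulr1//=.
by rewrite (negbTE ji) mulr0.
Qed.

Lemma punctured_someE u : punctured (Some u) <-> u != 0.
Proof. by split=> [[v v0 [<-]]//|u0]; exists u. Qed.

Lemma open_punctured : open punctured.
Proof.
apply: one_point_compactification_open_some.
rewrite (_ : [set u | u != 0] = ~` [set 0]).
  exact/closed_openC/accessible_closed_set1/hausdorff_accessible/norm_hausdorff.
by apply/seteqP; split=> u /eqP.
Qed.

Lemma finite_punctured : finite_domain punctured.
Proof. by move=> _ [u _ <-]; exists u. Qed.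

Lemma connected_segment u v :
  connected [set u + t *: (v - u) | t in `[0 : R, 1]].
Proof.
apply: connected_continuous_connected; first exact: segment_connected.
apply: continuous_subspaceT => t.
by apply: cvgD; [exact: cvg_cst|apply: cvgZr_tmp; exact: cvg_id].
Qed.

(* The path from [e i0] to u is the segment, or goes through [e i1] if the
   segment meets 0. *)
Lemma connected_nonzero (i0 i1 : 'I_n) : i0 != i1 ->
  connected [set u : 'rV[R]_n | u != 0].
Proof.
move=> /negbTE i01; have i10 : (i1 == i0) = false by rewrite eq_sym.
pose S := [set u : 'rV[R]_n | u != 0].
pose seg u v := [set u + t *: (v - u) | t in `[0 : R, 1]].
have seg0 u v : seg u v u.
  by exists 0; rewrite /= ?in_itv/= ?lexx ?ler01// scale0r addr0.
have seg1 u v : seg u v v.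
  by exists 1; rewrite /= ?in_itv/= ?lexx ?ler01// scale1r subrKC.
have e01 : seg (e i0) (e i1) `<=` S.
  move=> _ [t _ <-]; apply/eqP => /rowP h.
  by have := h i0; have := h i1; rewrite !mxE !eqxx i01 i10 /=; lra.
suff -> : [set u | u != 0] = connected_component S (e i0).
  exact: component_connected.
apply/seteqP; split=> [u u0|]; last exact: connected_component_sub.
have [h|] := pselect (seg (e i0) u `<=` S).
  by exists (seg (e i0) u); [split; [exact: seg0|exact: h|exact: connected_segment]|exact: seg1].
move=> /existsNP[z /not_implyP[[t]]].
rewrite /= in_itv/= => /andP[t0 t1] <- /negP; rewrite negbK => /eqP/rowP tu.
(* A zero on the segment makes u a multiple of [e i0]: it cannot occur at t = 0, where the point is
   [e i0]. *)
have u1 : u 0 i1 = 0.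
  have := tu i1; rewrite !mxE eqxx/= i10 subr0 add0r => /eqP.
  rewrite mulf_eq0 => /orP[/eqP t00|/eqP//].
  by have := tu i0; rewrite !mxE t00 mul0r addr0 !eqxx => /eqP; rewrite oner_eq0.
(* The coordinate [i1] is 1 - r along this segment, so a zero could only be its end point u, which
   is nonzero. *)
have h : seg (e i1) u `<=` S.
  move=> _ [r _ <-]; apply/eqP => ru.
  have r1 : r = 1.
    have := congr1 (fun w : 'rV[R]_n => w 0 i1) ru; rewrite !mxE !eqxx/= u1; lra.
  by move: ru u0 => /=; rewrite r1 scale1r subrKC => ->; rewrite eqxx.
exists (seg (e i0) (e i1) `|` seg (e i1) u); last by right; exact: seg1.
split.
- by left; exact: seg0.
- by move=> z0 [/e01|/h].
- apply: connectedU; [|exact: connected_segment|exact: connected_segment].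
  by exists (e i1); split; [exact: seg1|exact: seg0].
Qed.

(** The index [i] provides a direction along which 0 and oo are approached. *)
Lemma boundary_punctured (i : 'I_n) a :
  boundary punctured a <-> a = Some 0 \/ a = None.
Proof.
split=> [/(boundary_notin open_punctured)|].
  case: a => [u|]; last by right.
  by move=> /punctured_someE/negP; rewrite negbK => /eqP ->; left.
move=> a0; split; last first.
  by move=> /interior_subset; case: a0 => -> [u /= u0 []// u0']; rewrite u0' eqxx in u0.
have ne k : 0 < k -> punctured (Some (k *: e i)).
  move=> k0; apply/punctured_someE; apply/eqP => /(congr1 (@eucl_norm R n)).
  by rewrite eucl_normZ eucl_norm_delta eucl_norm0 mulr1 gtr0_norm//; lra.
case: a0 => -> U.
  move=> /some_ball_subset[r r0 rU]; exists (Some ((r / 2) *: e i)); split.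
    by apply: ne; lra.
  apply: rU; rewrite eucl_distC /eucl_dist subr0 eucl_normZ eucl_norm_delta mulr1.
  by rewrite gtr0_norm; lra.
move=> /none_ball_subset[M M0 MU]; exists (Some ((M + 1) *: e i)); split.
  by apply: ne; lra.
by apply: MU; rewrite eucl_normZ eucl_norm_delta mulr1 gtr0_norm; lra.
Qed.

Section Metrics.
Variables (i : 'I_n) (u v : 'rV[R]_n).
Hypotheses (u0 : u != 0) (v0 : v != 0) (uv : eucl_norm u <= eucl_norm v).
Let r := eucl_dist u v.
Let bP a := boundary_punctured i a.
Let oP := open_punctured.
Let Pu : punctured (Some u). Proof. exact/punctured_someE. Qed.
Let Pv : punctured (Some v). Proof. exact/punctured_someE. Qed.
Let un0 := eucl_norm_gt0 u0.
Let vn0 := eucl_norm_gt0 v0.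
Let r0 : 0 <= r. Proof. exact: eucl_dist_ge0. Qed.

Let cross_ratio_0oo w z :
  cross_ratio (Some 0 : mobius_space R n) (Some w) None (Some z) =
  eucl_dist w z / eucl_norm w.
Proof.
rewrite cross_ratioE /= mulr1 mul1r (eucl_distC 0 w).
by rewrite [eucl_dist w 0]/eucl_dist subr0.
Qed.

Let cross_ratio_oo0 w z :
  cross_ratio None (Some w) (Some 0 : mobius_space R n) (Some z) =
  eucl_dist w z / eucl_norm z.
Proof. by rewrite cross_ratio_swap cross_ratio_0oo eucl_distC. Qed.

Let cross_ratio_diag a x y : cross_ratio a x a y = 0.
Proof. by rewrite cross_ratioE flat_distxx !mul0r. Qed.

(** The pairs (0, oo) and (oo, 0) give r / |u| and r / |v|, and the former dominates because |u| <=
    |v|. *)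
Lemma delta_punctured :
  delta punctured (Some u) (Some v) = ln (1 + r / eucl_norm u).
Proof.
have ru0 : 0 <= r / eucl_norm u by rewrite divr_ge0// ltW.
have rv0 : 0 <= r / eucl_norm v by rewrite divr_ge0// ltW.
apply/eqP; rewrite eq_le; apply/andP; split.
  apply: delta_le => [|a b /bP ha /bP hb]; first by exists None; apply/bP; right.
  case: ha => ->; case: hb => ->; rewrite ?cross_ratio_diag ?cross_ratio_0oo
    ?cross_ratio_oo0 -?/r //; apply: ler_ln_pos; rewrite ?lerD2l//; try lra.
  by rewrite ler_wpM2l// lef_pV2.
rewrite /r -cross_ratio_0oo; apply: le_delta => //; apply/bP; first by left.
by right.
Qed.

Lemma rho_punctured : rho punctured (Some u) (Some v) =
  arch (1 + r / eucl_norm u * (r / eucl_norm v) / 2).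
Proof.
have h0 : 0 <= r / eucl_norm u * (r / eucl_norm v).
  by rewrite mulr_ge0// divr_ge0// ltW.
apply/eqP; rewrite eq_le; apply/andP; split.
  apply: rho_le => [|a b /bP ha /bP hb]; first by exists None; apply/bP; right.
  case: ha => ->; case: hb => ->; rewrite ?cross_ratio_diag ?cross_ratio_0oo
    ?cross_ratio_oo0 ?(eucl_distC v u) -?/r ?[r / eucl_norm v * _]mulrC //;
    by apply: arch_mono; lra.
rewrite /r -{1}cross_ratio_0oo (eucl_distC u v) -cross_ratio_0oo.
by apply: le_rho => //; apply/bP; [left|right].
Qed.

Lemma jmetric_punctured :
  jmetric punctured (Some u) (Some v) = ln (1 + r / eucl_norm u).
Proof.
have bd w : bdist punctured w = eucl_norm w.
  rewrite /bdist (_ : [set _ | _ in _] = [set eucl_norm w]) ?inf1//.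
  apply/seteqP; split=> z /=.
    by case=> z' /bP[[->]|//] <-; rewrite /eucl_dist subr0.
  by move=> ->; exists 0; rewrite /eucl_dist ?subr0//; apply/bP; left.
by rewrite /= !bd min_l.
Qed.
End Metrics.

End PuncturedSpace.

Unset Implicit Arguments.
Set Strict Implicit.

Theorem theorem1p3 (R : realType) (n : nat) (hn : (2 <= n)%N) :
  (forall G : set (mobius_space R n), admissible_domain G ->
     (forall x y : mobius_space R n, G x -> G y ->
        delta G x y <= rho G x y /\
        rho G x y <= arch 3 / ln 3 * delta G x y) /\
     (finite_domain G ->
      forall x y : mobius_space R n, G x -> G y ->
        jmetric G x y <= rho G x y /\
        rho G x y <= arch 3 / ln 2 * jmetric G x y)) /\
  sharp (@admissible_domain R n) delta rho 1 /\
  sharp (@admissible_domain R n) rho delta (arch 3 / ln 3) /\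
  sharp (fun G : set (mobius_space R n) => admissible_domain G /\ finite_domain G)
    jmetric rho 1.
Proof.
(* Two distinct coordinates exist because n >= 2; they make the punctured space connected. *)
pose i0 := Ordinal (ltnW hn); pose i1 := Ordinal hn.
pose e : 'rV[R]_n := delta_mx 0 i0.
have e1 : eucl_norm e = 1 by exact: eucl_norm_delta.
have e0 : e != 0 by apply/eqP => e0; move: e1; rewrite e0 eucl_norm0; lra.
have admP : admissible_domain (@punctured R n).
  split; first exact: open_punctured.
    apply: connected_continuous_connected.
      exact: (@connected_nonzero _ _ i0 i1).
    exact/continuous_subspaceT/one_point_compactification_some_continuous.
  apply/card_ge2P; exists (Some 0), None; split => //.
    by apply/(boundary_punctured i0); left.
  by apply/(boundary_punctured i0); right.
have ke0 (k : R) : k != 0 -> k *: e != 0 by move=> k0; rewrite scaler_eq0 negb_or k0.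
have ke (k : R) : eucl_norm (k *: e) = `|k| by rewrite eucl_normZ e1 mulr1.
have dke (k : R) : eucl_dist e (k *: e) = `|1 - k|.
  by rewrite /eucl_dist -{1}[e]scale1r -scalerBl ke.
have neq (k : R) : k != 1 -> Some e <> Some (k *: e) :> mobius_space R n.
  move=> k1 [/eqP]; rewrite -{1}[e]scale1r -subr_eq0 -scalerBl scaler_eq0.
  by rewrite (negbTE e0) orbF subr_eq0 eq_sym (negbTE k1).
have two0 : 2 != 0 :> R by rewrite gt_eqF//; lra.
have two1 : 2 != 1 :> R by rewrite gt_eqF//; lra.
have m10 : -1 != 0 :> R by rewrite lt_eqF//; lra.
have m11 : -1 != 1 :> R by rewrite lt_eqF//; lra.
have e2 : eucl_norm e <= eucl_norm (2 *: e) by rewrite ke e1 ger0_norm; lra.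
have em1 : eucl_norm e <= eucl_norm (-1 *: e) by rewrite ke e1 normrN1.
have n2 : `|1 - 2| = 1 :> R by rewrite ltr0_norm; lra.
have n3 : `|1 - -1| = 2 :> R by rewrite ger0_norm; lra.
have delta2 : delta (@punctured R n) (Some e) (Some (2 *: e)) = ln 2.
  by rewrite (delta_punctured i0)// ?ke0// dke n2 e1 divr1.
(* With r = 1, the argument of [arch] is 5/4 = (2 + 1/2) / 2 = cosh (ln 2). *)
have rho2 : rho (@punctured R n) (Some e) (Some (2 *: e)) = ln 2.
  rewrite (rho_punctured i0)// ?ke0// dke n2 e1 ke ger0_norm//.
  by rewrite -arch_cosh; [congr arch; field|lra].
have j2 : jmetric (@punctured R n) (Some e) (Some (2 *: e)) = ln 2.
  by rewrite (jmetric_punctured i0)// ?ke0// dke n2 e1 divr1.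
have deltaN : delta (@punctured R n) (Some e) (Some (-1 *: e)) = ln 3.
  by rewrite (delta_punctured i0)// ?ke0// dke n3 e1 divr1; congr ln; lra.
have rhoN : rho (@punctured R n) (Some e) (Some (-1 *: e)) = arch 3.
  rewrite (rho_punctured i0)// ?ke0// dke n3 e1 ke normrN1 divr1.
  by congr arch; field.
have ln20 := ln2_gt0 R.
split; last first.
  (* Each sharp constant is attained at a pair of points, so constant sequences suffice. *)
  split; last split.
  - exists (@punctured R n); split => //.
    exists (fun=> Some e), (fun=> Some (2 *: e)); split.
      by split; [exact/punctured_someE|exact/punctured_someE/ke0|exact: neq].
    by rewrite delta2 rho2 divff ?gt_eqF//; exact: cvg_cst.
  - exists (@punctured R n); split => //.
    exists (fun=> Some e), (fun=> Some (-1 *: e)); split.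
      by split; [exact/punctured_someE|exact/punctured_someE/ke0|exact: neq].
    by rewrite deltaN rhoN; exact: cvg_cst.
  - exists (@punctured R n); split; first by split => //; exact: finite_punctured.
    exists (fun=> Some e), (fun=> Some (2 *: e)); split.
      by split; [exact/punctured_someE|exact/punctured_someE/ke0|exact: neq].
    by rewrite j2 rho2 divff ?gt_eqF//; exact: cvg_cst.
move=> G [oG _ /card_ge2P[a [b [Ga Gb ab]]]].
have G0 : boundary G !=set0 by exists a.
split=> [x y Gx Gy|fG x y Gx Gy].
  by split; [exact: delta_le_rho|exact: rho_le_delta].
(* Two distinct boundary points cannot both be oo. *)
have [w Gw] : exists w, boundary G (Some w).
  by case: a b Ga Gb ab {G0} => [w|] [w'|] Ga Gb ab //; [exists w|exists w|exists w'].
split; last exact: (rho_le_jmetric oG fG Gw).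
by apply: le_trans (delta_le_rho oG Gx Gy G0); exact: (jmetric_le_delta oG fG Gw).
Qed.
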